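(* Let $b=\dfrac{-1+\sqrt{11}}{2}$, $c=\dfrac{-1-\sqrt{11}}{2}$, and $T_n=n(n+1)/2$. Then for every integer $m\ge 1$, $$\frac{1}{2m+3}\sum_{j=1}^m\bigl(1+bj+cj^2\bigr)\bigl(-1-cj-bj^2\bigr)=T_{m-1}^2.$$
   Context: $T_n=n(n+1)/2$ is the $n$th triangular number (with $T_0=0$). *)

(* Defs.v *)
From mathcomp Require Import all_boot all_order all_algebra.
From mathcomp Require Import reals.

Set Implicit Arguments.
Unset Strict Implicit.
Unset Printing Implicit Defensive.

(* The division is exact, since n * (n + 1) is even. *)
Definition triangular (n : nat) : nat := (n * (n + 1)) %/ 2.

(* Main.v *)
Require Import Defs.
From mathcomp Require Import all_boot all_order all_algebra.
From mathcomp Require Import reals.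
From mathcomp Require Import ring.

Set Implicit Arguments.
Unset Strict Implicit.
Unset Printing Implicit Defensive.

Import Order.TTheory GRing.Theory Num.Theory.
Local Open Scope ring_scope.

(** The second factor is minus the first with [b] and [c] swapped, so each summand is symmetric in
    them and depends only on [b + c = -1] and [b * c = -5/2]. It equals (5j^4 - 12j^3 + 7j^2 + 2j -
    2)/2, which is F(j) - F(j-1) for F(m) = (2m+3) T_{m-1}^2; as F(0) = 0, the sum telescopes to
    F(m). *)

Lemma natr_triangular (R : numFieldType) (n : nat) :
  (triangular n)%:R = n%:R * (n%:R + 1) / 2 :> R.
Proof.
have even_nn1 : (2 %| n * (n + 1))%N by rewrite dvdn2 oddM addn1 /= andbN.
apply/(canRL (mulfK _)); first by rewrite pnatr_eq0.
by rewrite -natrM divnK // natrM natrD.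
Qed.

(* Each summand is the increment of the closed form, and by symmetry in b and c
   only b + c and b * c enter. *)
Lemma sum_conjugate_quadratics (R : numFieldType) (b c : R) (m : nat) :
  b + c = -1 -> b * c = - (5 / 2) ->
  \sum_(1 <= j < m.+1)
     (1 + b * j%:R + c * j%:R ^+ 2) * (-1 - c * j%:R - b * j%:R ^+ 2)
  = (2 * m%:R + 3) * (m%:R * (m%:R - 1) / 2) ^+ 2.
Proof.
move=> sum_bc prod_bc; elim: m => [|m IHm].
  by rewrite big_geq // !mul0r expr0n mulr0.
rewrite big_nat_recr //= {}IHm -(natr1 m); set x := m%:R.
(* The cubic coefficient is b^2 + c^2, written through [b + c] and [b * c]. *)
have -> : (1 + b * (x + 1) + c * (x + 1) ^+ 2)
    * (-1 - c * (x + 1) - b * (x + 1) ^+ 2)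
  = - (1 + (b + c) * ((x + 1) + (x + 1) ^+ 2)
       + (b * c) * ((x + 1) ^+ 2 + (x + 1) ^+ 4)
       + ((b + c) ^+ 2 - 2 * (b * c)) * (x + 1) ^+ 3) by ring.
by rewrite sum_bc prod_bc; field.
Qed.

Theorem mainTheorem4 (R : realType) (m : nat) (hm : (1 <= m)%N) :
  let b : R := (-1 + Num.sqrt 11) / 2 in
  let c : R := (-1 - Num.sqrt 11) / 2 in
  1 / (2 * m%:R + 3) *
    (\sum_(1 <= j < m.+1)
       (1 + b * j%:R + c * j%:R ^+ 2) * (-1 - c * j%:R - b * j%:R ^+ 2))
  = (triangular (m - 1))%:R ^+ 2.
Proof.
move=> b c.
have sqrt11 : Num.sqrt 11 ^+ 2 = 11 :> R by rewrite sqr_sqrtr // ler0n.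
have sum_bc : b + c = -1 by rewrite /b /c; field.
have prod_bc : b * c = - (5 / 2).
  (* [field] treats the root as an atom, so its square is isolated for [sqrt11]. *)
  have -> : b * c = (1 - Num.sqrt 11 ^+ 2) / 4 by rewrite /b /c; field.
  by rewrite sqrt11; field.
(* [natrB] uses [hm]: the subtraction [m - 1] is not truncated. *)
rewrite sum_conjugate_quadratics // natr_triangular natrB //.
have den_neq0 : 2 * m%:R + 3 != 0 :> R by rewrite -natrM -natrD pnatr_eq0 addn3.
by field.
Qed.
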